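(* Let $1\le p<\infty$, let $d_{w,p}$ be a Lorentz sequence space, and let $X$ and $Y$ be closed subspaces of $d_{w,p}$. Then $\mathcal{FSS}(X,Y)=\mathcal{SS}(X,Y)$. In particular, $\mathcal{FSS}(\ell_p,d_{w,p})=\mathcal{SS}(\ell_p,d_{w,p})$ and $\mathcal{FSS}(d_{w,p})=\mathcal{SS}(d_{w,p})$.
   Context: Let $1\le p<\infty$ and let $w=(w_n)$ be a real sequence with $w_1=1$, $w_n\downarrow 0$ and $\sum_n w_n=\infty$. The Lorentz sequence space $d_{w,p}$ is the Banach space of all $x=(x_n)\in c_0$ with $\|x\|_{d_{w,p}}=\big(\sum_{n}w_n (x^*_n)^p\big)^{1/p}<\infty$, where $(x^*_n)$ is the non-increasing rearrangement of $(|x_n|)$. $\mathcal{SS}(X,Y)$ is the set of strictly singular operators $T\in L(X,Y)$: no restriction of $T$ to an infinite-dimensional closed subspace is an isomorphism. $\mathcal{FSS}(X,Y)$ is the set of finitely strictly singular operators: $T\in L(X,Y)$ such that for every $\varepsilon>0$ there is $N\in\mathbb N$ such that every subspace $Z\subseteq X$ with $\dim Z\ge N$ contains $z$ with $\|Tz\|<\varepsilon\|z\|$. *)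

(* Defs.v *)
From HB Require Import structures.
From mathcomp Require Import all_boot all_order all_algebra.
From mathcomp Require Import all_classical all_reals all_analysis.
Set Implicit Arguments. Unset Strict Implicit. Unset Printing Implicit Defensive.
Import Order.TTheory GRing.Theory Num.Theory.
Import numFieldNormedType.Exports.
Local Open Scope classical_set_scope.
Local Open Scope ring_scope.

Section Lorentz.
Variable R : realType.

Definition c0 (x : nat -> R) : Prop := x n @[n --> \oo] --> (0 : R).

(* non-increasing rearrangement of (|x_k|), 0-indexed:
   xstar x n = inf { t >= 0 : #{k : |x_k| > t} <= n }
   (the (n+1)-st largest value of |x_k|, for x in c_0). *)
Definition xstar (x : nat -> R) (n : nat) : R :=
  inf [set t : R | 0 <= t /\
        exists s : seq nat, (size s <= n)%N /\ (forall k, t < `|x k| -> k \in s)].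

Definition dwp (w : nat -> R) (p : R) (x : nat -> R) : Prop :=
  c0 x /\ cvg ((series (fun n => w n * (xstar x n) `^ p)) @ \oo).

Definition dnorm (w : nat -> R) (p : R) (x : nat -> R) : R :=
  (limn (series (fun n => w n * (xstar x n) `^ p))) `^ (p^-1).

Definition lp (p : R) (x : nat -> R) : Prop :=
  cvg ((series (fun n => `|x n| `^ p)) @ \oo).

Definition lpnorm (p : R) (x : nat -> R) : R :=
  (limn (series (fun n => `|x n| `^ p))) `^ (p^-1).

Definition is_subspace (S : set (nat -> R)) : Prop :=
  S (fun _ => 0) /\
  (forall x y, S x -> S y -> S (fun k => x k + y k)) /\
  (forall (a : R) x, S x -> S (fun k => a * x k)).

Definition closed_in (E : set (nat -> R)) (nrm : (nat -> R) -> R)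
  (S : set (nat -> R)) : Prop :=
  forall (u : nat -> nat -> R) (x : nat -> R),
    (forall n, S (u n)) -> E x ->
    nrm (fun k => u n k - x k) @[n --> \oo] --> (0 : R) -> S x.

Definition closed_subspace (E : set (nat -> R)) (nrm : (nat -> R) -> R)
  (S : set (nat -> R)) : Prop :=
  S `<=` E /\ is_subspace S /\ closed_in E nrm S.

Definition lin_indep (N : nat) (v : nat -> nat -> R) : Prop :=
  forall c : nat -> R,
    (forall k, \sum_(i < N) c i * v i k = 0) -> forall i, (i < N)%N -> c i = 0.

Definition dim_ge (N : nat) (Z : set (nat -> R)) : Prop :=
  exists v : nat -> nat -> R, (forall i, (i < N)%N -> Z (v i)) /\ lin_indep N v.

Definition infinite_dim (Z : set (nat -> R)) : Prop := forall N, dim_ge N Z.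

(* T : (X, nX) -> (Y, nY) is a bounded linear operator, i.e. T \in L(X,Y)
   (only the values of T on X matter). *)
Definition bounded_linear (X Y : set (nat -> R)) (nX nY : (nat -> R) -> R)
  (T : (nat -> R) -> (nat -> R)) : Prop :=
  (forall x, X x -> Y (T x)) /\
  (forall x y, X x -> X y -> T (fun k => x k + y k) = (fun k => T x k + T y k)) /\
  (forall (a : R) x, X x -> T (fun k => a * x k) = (fun k => a * T x k)) /\
  (exists C : R, forall x, X x -> nY (T x) <= C * nX x).

(* the restriction of (bounded) T to Z is an isomorphism onto its range *)
Definition iso_on (Z : set (nat -> R)) (nX nY : (nat -> R) -> R)
  (T : (nat -> R) -> (nat -> R)) : Prop :=
  exists c : R, 0 < c /\ forall z, Z z -> c * nX z <= nY (T z).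

Definition SS (X : set (nat -> R)) (nX nY : (nat -> R) -> R)
  (T : (nat -> R) -> (nat -> R)) : Prop :=
  ~ (exists Z : set (nat -> R),
       closed_subspace X nX Z /\ infinite_dim Z /\ iso_on Z nX nY T).

Definition FSS (X : set (nat -> R)) (nX nY : (nat -> R) -> R)
  (T : (nat -> R) -> (nat -> R)) : Prop :=
  forall eps : R, 0 < eps ->
    exists N : nat, forall Z : set (nat -> R),
      Z `<=` X -> is_subspace Z -> dim_ge N Z ->
      exists z, Z z /\ nY (T z) < eps * nX z.

End Lorentz.

(* Main.v *)
Require Import Defs.
From HB Require Import structures.
From mathcomp Require Import all_boot all_order all_algebra.
From mathcomp Require Import all_classical all_reals all_analysis.
From mathcomp Require Import ring lra zify.
Import Order.TTheory GRing.Theory Num.Theory.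
Import numFieldNormedType.Exports.
Local Open Scope classical_set_scope.
Local Open Scope ring_scope.

(* If [T] is not finitely strictly singular, it is bounded below on subspaces of
   [X] of arbitrarily large finite dimension. Milman's flat vectors, applied to the
   graph of [T], give normalized [z] far out in [X] such that [T z] has small sup
   norm and norm bounded below. Since the weights sum to infinity, the first [L]
   places of the rearrangement of such a [T z] contribute little, so its mass sits
   at later positions; choosing [z_1, z_2, ...] successively, the images can be put
   at disjoint ranges of positions, and [(T z_j)] dominates the basis of [l_p].
   Conversely almost disjoint normalized sequences satisfy an upper [l_p] estimate,
   so [T] is an isomorphism on the closed span of [(z_j)].
   Only [p]-th powers of norms are manipulated, with the quasi-triangle inequality
   of constant [2^p] in place of Minkowski's inequality. *)

(** * Weighted sums along sequences of positions *)

Section WeightedSums.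
Context {R : realType} (p : R).
Hypothesis hp : 1 <= p.

Lemma exponent_gt0 : 0 < p. Proof. exact: lt_le_trans hp. Qed.
Lemma exponent_neq0 : p != 0. Proof. by rewrite gt_eqF ?exponent_gt0. Qed.
Let hp0 := exponent_gt0.
Let hpn := exponent_neq0.

Lemma norm_powR_le (a b : R) : `|a| <= `|b| -> `|a| `^ p <= `|b| `^ p.
Proof. by move=> ab; apply: ge0_ler_powR; rewrite ?nnegrE ?normr_ge0 // ltW. Qed.

(** The sum is at most twice the larger of the two moduli. *)
Lemma norm_powRD (a b : R) :
  `|a + b| `^ p <= 2 `^ p * (`|a| `^ p + `|b| `^ p).
Proof.
wlog ab : a b / `|a| <= `|b|.
  move=> H; case: (leP `|a| `|b|) => [|/ltW] /H //.
  by rewrite addrC [X in _ * X]addrC.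
have -> : 2 `^ p * (`|a| `^ p + `|b| `^ p) =
          `|2 * b| `^ p + 2 `^ p * `|a| `^ p.
  by rewrite normrM powRM ?normr_ge0 // ger0_norm // -mulrDr addrC.
apply: le_trans (_ : `|2 * b| `^ p <= _); last first.
  by rewrite lerDl mulr_ge0 ?powR_ge0.
apply: norm_powR_le; rewrite normrM ger0_norm //.
by apply: le_trans (ler_normD _ _) _; lra.
Qed.

(** Supplies the sup-norm bound [d] under which leading places of total weight [S] contribute at
    most [e]. *)
Lemma exists_powR_mul_le (S e : R) : 0 <= S -> 0 < e ->
  exists2 d : R, 0 < d & d `^ p * S <= e.
Proof.
move=> S0 e0; exists ((e / (1 + S)) `^ p^-1); first by rewrite powR_gt0 // divr_gt0 //; lra.
rewrite -powRrM mulVf // powRr1; last by rewrite divr_ge0 //; lra.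
by rewrite mulrAC ler_pdivrMr; [rewrite ler_wpM2l; lra|lra].
Qed.

(* [wsum w x k s] is the sum of [w (k + i) * |x s_i|^p] over the positions [i]
   of [s]; the supremum of [wsum w x 0] over the duplicate-free sequences is the
   [p]-th power of the Lorentz norm of [x]. *)
Fixpoint wsum (w x : nat -> R) (k : nat) (s : seq nat) : R :=
  if s is i :: s' then w k * `|x i| `^ p + wsum w x k.+1 s' else 0.

(** Bounds the p-th power of the Lorentz norm by [c] without presupposing that [x] tends to 0 or
    that a series converges. *)
Definition dominated (w x : nat -> R) (c : R) :=
  forall s, uniq s -> wsum w x 0 s <= c.

Lemma wsum_cat w x k s t :
  wsum w x k (s ++ t) = wsum w x k s + wsum w x (k + size s) t.
Proof.
elim: s k => [|i s IH] k /=; first by rewrite add0r addn0.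
by rewrite IH addrA addSnnS.
Qed.

Lemma wsumZ w x a k s :
  wsum w (fun i => a * x i) k s = `|a| `^ p * wsum w x k s.
Proof.
elim: s k => [|i s IH] k /=; first by rewrite mulr0.
by rewrite IH normrM powRM ?normr_ge0 //; ring.
Qed.

Lemma eq_wsum w x y k s :
  (forall i, i \in s -> x i = y i) -> wsum w x k s = wsum w y k s.
Proof.
elim: s k => //= i s IH k H; rewrite H ?mem_head // IH // => j js.
by apply: H; rewrite inE js orbT.
Qed.

Lemma wsum_iota w x n : wsum w x 0 (iota 0 n) = \sum_(0 <= i < n) w i * `|x i| `^ p.
Proof.
elim: n => [|n IH]; first by rewrite big_nil.
by rewrite -addn1 iotaD wsum_cat IH /= size_iota !add0n addn1 big_nat_recr //= addr0.
Qed.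

Section Weight.
Variable w : nat -> R.
Hypothesis w0 : forall n, 0 <= w n.
Hypothesis wdec : forall m n, (m <= n)%N -> w n <= w m.

Lemma wsum_le x y k s :
  (forall i, i \in s -> `|x i| <= `|y i|) -> wsum w x k s <= wsum w y k s.
Proof.
elim: s k => //= i s IH k H; rewrite lerD //.
  by rewrite ler_wpM2l // norm_powR_le // H ?mem_head.
by apply: IH => j js; apply: H; rewrite inE js orbT.
Qed.

Lemma wsum_shift x k l s : (k <= l)%N -> wsum w x l s <= wsum w x k s.
Proof.
elim: s k l => //= i s IH k l kl; rewrite lerD // ?IH //.
by rewrite ler_wpM2r ?powR_ge0 ?wdec.
Qed.

(** Deleting null entries moves the later ones to earlier positions, where the weights are no
    smaller. *)
Lemma wsum_filter (P : pred nat) x k s :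
  (forall i, ~~ P i -> x i = 0) -> wsum w x k s <= wsum w x k (seq.filter P s).
Proof.
move=> H; elim: s k => //= i s IH k; case: ifPn => Pi /=; first by rewrite lerD2l.
rewrite H // normr0 powR0 // mulr0 add0r.
by apply: le_trans (wsum_shift x _ _ s (leqnSn k)) _.
Qed.

Lemma wsumD x y k s :
  wsum w (fun i => x i + y i) k s <= 2 `^ p * (wsum w x k s + wsum w y k s).
Proof.
elim: s k => [|i s IH] k /=; first by rewrite addr0 mulr0.
apply: le_trans (lerD (ler_wpM2l (w0 k) (norm_powRD (x i) (y i))) (IH _)) _.
by rewrite le_eqVlt; apply/orP; left; apply/eqP; ring.
Qed.

Lemma wsum_disjointD x y k s :
  (forall i, x i = 0 \/ y i = 0) ->
  wsum w (fun i => x i + y i) k s = wsum w x k s + wsum w y k s.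
Proof.
move=> xy; elim: s k => [|i s IH] k /=; first by rewrite addr0.
by rewrite IH; case: (xy i) => ->; rewrite ?add0r ?addr0 normr0 powR0 //; ring.
Qed.

Lemma wsum_cst x d k s : 0 <= d -> (forall i, i \in s -> `|x i| = d) ->
  wsum w x k s = d `^ p * \sum_(k <= i < k + size s) w i.
Proof.
move=> d0; elim: s k => [|i s IH] k H /=; first by rewrite addn0 big_geq // mulr0.
rewrite H ?mem_head // IH; last by move=> j js; apply: H; rewrite inE js orbT.
rewrite -addSnnS (big_ltn (_ : k < _)%N); last by rewrite addSn ltnS leq_addr.
by rewrite mulrDr [w k * _]mulrC.
Qed.

Lemma wsum_le_cst x d k s : (forall i, i \in s -> `|x i| <= d) ->
  wsum w x k s <= d `^ p * \sum_(k <= i < k + size s) w i.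
Proof.
case: s => [|i0 s] H; first by rewrite /= addn0 big_geq // mulr0.
have d0 : 0 <= d by apply: le_trans (H i0 (mem_head _ _)); rewrite normr_ge0.
rewrite -(@wsum_cst (fun=> d) _ _ (i0 :: s)) //; last by move=> *; rewrite /= ger0_norm.
by apply: wsum_le => i /H; rewrite /= (ger0_norm d0).
Qed.

Lemma sum_weight_le m n : (m <= n)%N -> \sum_(0 <= i < m) w i <= \sum_(0 <= i < n) w i.
Proof.
by move=> mn; rewrite (big_cat_nat _ mn) //= lerDl sumr_ge0.
Qed.

Lemma dominated_le x y c : (forall i, `|x i| <= `|y i|) -> dominated w y c -> dominated w x c.
Proof. by move=> xy yc s us; apply: le_trans (wsum_le _ _ _ _ _) (yc s us). Qed.

Lemma dominatedD x y c d : dominated w x c -> dominated w y d ->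
  dominated w (fun i => x i + y i) (2 `^ p * (c + d)).
Proof.
move=> xc yd s us; apply: le_trans (wsumD _ _ _ _) _.
by rewrite ler_wpM2l ?powR_ge0 // lerD ?xc ?yd.
Qed.

Lemma dominatedZ x a c : dominated w x c -> dominated w (fun i => a * x i) (`|a| `^ p * c).
Proof. by move=> xc s us; rewrite wsumZ ler_wpM2l ?powR_ge0 ?xc. Qed.

(* The first [L] terms of [s] contribute at most [eta / 2], so the remaining ones,
   which keep their positions, carry the rest. *)
Lemma far_block x L m d eta s :
  uniq s -> (forall k, (k < m)%N -> x k = 0) -> (forall k, `|x k| <= d) ->
  d `^ p * \sum_(0 <= i < L) w i <= eta / 2 -> eta < wsum w x 0 s ->
  exists t, [/\ uniq t, forall k, k \in t -> (m <= k)%N & eta / 2 <= wsum w x L t].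
Proof.
move=> us xm xd Ld es; exists (seq.filter (fun k => m <= k)%N (drop L s)); split.
- by rewrite filter_uniq // drop_uniq.
- by move=> k; rewrite mem_filter => /andP[].
apply: le_trans (wsum_filter _ _ _ _ _); last by move=> i; rewrite -ltnNge => /xm.
have d0 : 0 <= d by apply: le_trans (xd 0%N); rewrite normr_ge0.
have tk : wsum w x 0 (take L s) <= eta / 2.
  apply: le_trans (wsum_le_cst _ _ _ _ (fun i _ => xd i)) _.
  apply: le_trans Ld; rewrite add0n ler_wpM2l ?powR_ge0 // sum_weight_le //.
  by rewrite size_take; case: ltnP.
move: es; rewrite -{1}(cat_take_drop L s) wsum_cat add0n => es.
(* When [s] has fewer than [L] entries, the two bounds force [eta < 0], and the empty remainder is
   enough. *)
case: (leqP L (size s)) => Ls; last first.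
  move: es; rewrite drop_oversize /= ?addr0 => [es|]; last exact: ltnW.
  by move: es tk; rewrite /=; lra.
by move: es; rewrite size_takel //; move: tk; lra.
Qed.

(** * Decay of coordinates and tails for weights of infinite sum *)

Section Divergent.
Hypothesis winf : series w n @[n --> \oo] --> +oo.

Lemma sum_weight_large A : exists n, A <= \sum_(0 <= i < n) w i.
Proof.
have /cvgryPge/(_ A)[n _ Hn] := winf.
by exists n; have := Hn n (leqnn n); rewrite /series /=.
Qed.

(** Otherwise there are arbitrarily long lists of distinct coordinates of modulus above [e]; their
    weighted sums are at least [e^p] times the partial sums of [w], which are unbounded. *)
Lemma dominated_c0 x c e : dominated w x c -> 0 < e ->
  exists s : seq nat, forall k, e < `|x k| -> k \in s.
Proof.
move=> xc e0; apply: contrapT => /forallNP H.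
have H' n : exists s, [/\ uniq s, size s = n & forall k, k \in s -> e < `|x k|].
  elim: n => [|n [s [us ss xs]]]; first by exists [::].
  have /existsNP[k /not_implyP[ek ks]] := H s.
  exists (k :: s); split; rewrite /= ?us ?ss ?andbT //; first exact/negP.
  by move=> j; rewrite inE => /predU1P[->|/xs].
have [n Hn] := sum_weight_large (((`|c|) + 1) / e `^ p).
have [s [us ss xs]] := H' n.
have : e `^ p * \sum_(0 <= i < n) w i <= c.
  apply: le_trans (xc s us).
  have := @wsum_cst (fun=> e) e 0 s (ltW e0) (fun=> fun=> ger0_norm (ltW e0)).
  rewrite add0n ss => <-.
  by apply: wsum_le => k /xs /ltW; rewrite /= (ger0_norm (ltW e0)).
move: Hn; rewrite ler_pdivrMr ?powR_gt0 // mulrC => /le_trans h /h.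
by have := ler_norm c; lra.
Qed.

Definition tail_from (m : nat) (x : nat -> R) k := if (k < m)%N then 0 else x k.
Definition head_upto (m : nat) (x : nat -> R) k := if (k < m)%N then x k else 0.

(** Gliding hump: if every tail exceeded [eta], [far_block] would extend any list [s] by coordinates
    further out, placed right after [s] and adding at least [eta / 2]. Repetition contradicts the
    bound [c]. *)
Lemma dominated_tail x c eta : dominated w x c -> 0 < eta ->
  exists m0, forall m, (m0 <= m)%N -> dominated w (tail_from m x) eta.
Proof.
move=> xc eta0.
suff [m0 Hm0] : exists m, dominated w (tail_from m x) eta.
  exists m0 => m mm; apply: dominated_le Hm0 => i; rewrite /tail_from.
  case: ltnP => [|mi]; first by rewrite normr0 normr_ge0.
  by rewrite ltnNge (leq_trans mm mi).
apply: contrapT => /forallNP H.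
have H' n : exists2 s, uniq s & n%:R * (eta / 2) <= wsum w x 0 s.
  elim: n => [|n [s us xs]]; first by exists [::]; rewrite //= mul0r.
  pose L := size s.
  have [d d0 dL] : exists2 d : R, 0 < d & d `^ p * \sum_(0 <= i < L) w i <= eta / 2.
    by apply: exists_powR_mul_le; rewrite ?sumr_ge0 //; lra.
  have [t Ht] := dominated_c0 _ _ _ xc d0.
  (* From [m] on, no coordinate of [x] exceeds [d] in modulus and no index belongs to [s]. *)
  pose m := (\max_(i <- s ++ t) i).+1.
  have hm i : i \in s ++ t -> (i < m)%N.
    by move=> ist; rewrite ltnS; apply: (@leq_bigmax_seq _ _ xpredT id).
  have /existsNP[u /not_implyP[uu /negP]] := H m; rewrite -ltNge => xu.
  have [|||||v [uv mv Lv]] := far_block (tail_from m x) L m d eta u => //.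
  - by move=> k; rewrite /tail_from => ->.
  - move=> k; rewrite /tail_from; case: ltnP => mk; first by rewrite normr0 ltW.
    rewrite leNgt; apply/negP => /Ht kt.
    by have := hm k; rewrite mem_cat kt orbT ltnNge mk => /(_ isT).
  exists (s ++ v).
    rewrite cat_uniq us uv /= andbT; apply/hasPn => k /mv mk /=; apply/negP => ks.
    by have := hm k; rewrite mem_cat ks ltnNge mk => /(_ isT).
  rewrite wsum_cat add0n -natr1 mulrDl mul1r lerD //.
  apply: le_trans Lv _; rewrite le_eqVlt; apply/orP; left; apply/eqP.
  by apply: eq_wsum => k /mv mk; rewrite /tail_from ltnNge mk.
have [s us] := H' (Num.bound (c / (eta / 2))).
apply/negP; rewrite -ltNge; apply: le_lt_trans (xc s us) _.
rewrite -ltr_pdivrMr ?divr_gt0 //.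
by apply: archi_boundP; apply: divr_ge0; [exact: (xc [::])|lra].
Qed.

End Divergent.
End Weight.
End WeightedSums.

(** * Milman's flat vectors *)

Lemma same_sign_normrD (R : realDomainType) (a b : R) :
  0 <= a * b -> `|a + b| = `|a| + `|b|.
Proof. by move=> ab; case: (ger0P a); case: (ger0P b); case: (ger0P (a + b)); nra. Qed.

Section FlatVectors.
Context {R : realType} {I : eqType}.

(** This is c_0 over an index type without order, so that [nat + nat] can index the graph of an
    operator. *)
Definition vanishing (x : I -> R) :=
  forall e, 0 < e -> exists s : seq I, forall k, e < `|x k| -> k \in s.

Lemma vanishingD x y : vanishing x -> vanishing y -> vanishing (fun k => x k + y k).
Proof.
move=> vx vy e e0; have e2 : 0 < e / 2 by lra.
have [s hs] := vx _ e2; have [t ht] := vy _ e2; exists (s ++ t) => k ek.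
rewrite mem_cat; apply: contraTT ek; rewrite negb_or => /andP[ks kt].
have xk : `|x k| <= e / 2 by rewrite leNgt; apply: contra ks => /hs.
have yk : `|y k| <= e / 2 by rewrite leNgt; apply: contra kt => /ht.
by rewrite -leNgt; apply: le_trans (ler_normD _ _) _; lra.
Qed.

Lemma vanishingZ a x : vanishing x -> vanishing (fun k => a * x k).
Proof.
move=> vx e e0; have a0 : 0 < `|a| + 1 by have := normr_ge0 a; lra.
have [s hs] := vx (e / (`|a| + 1)) (divr_gt0 e0 a0); exists s => k.
rewrite normrM => ek; apply: hs; rewrite ltr_pdivrMr //.
by apply: lt_le_trans ek _; rewrite mulrC ler_wpM2l // lerDl.
Qed.

Lemma vanishing_sum N (c : nat -> R) (u : nat -> I -> R) :
  (forall i, (i < N)%N -> vanishing (u i)) ->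
  vanishing (fun k => \sum_(i < N) c i * u i k).
Proof.
elim: N => [|N IH] H.
  by move=> e e0; exists [::] => k; rewrite big_ord0 normr0 ltNge (ltW e0).
have -> : (fun k => \sum_(i < N.+1) c i * u i k) =
          (fun k => \sum_(i < N) c i * u i k + c N * u N k).
  by apply/funext => k; rewrite big_ord_recr.
by apply: vanishingD; [apply: IH => i /ltnW; exact: H|apply: vanishingZ; exact: H].
Qed.

Lemma seq_argmax (f : I -> R) (s : seq I) (k0 : I) : k0 \in s ->
  exists2 k, k \in s & forall j, j \in s -> f j <= f k.
Proof.
elim: s k0 => // a s IH k0 _; case: s IH => [|b s] IH.
  by exists a; rewrite ?mem_head // => j; rewrite inE => /eqP ->.
have [k ks hk] := IH b (mem_head _ _); have [ak|/ltW ka] := leP (f a) (f k).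
  exists k => [|j]; first by rewrite inE ks orbT.
  by rewrite inE => /predU1P[->|/hk].
exists a => [|j]; first exact: mem_head.
by rewrite inE => /predU1P[->|/hk jk] //; exact: le_trans ka.
Qed.

Lemma vanishing_argmax x (k0 : I) : vanishing x -> 0 < `|x k0| ->
  exists k, forall j, `|x j| <= `|x k|.
Proof.
move=> vx x0; have [|s hs] := vx (`|x k0| / 2); first by lra.
have k0s : k0 \in s by apply: hs; lra.
have [k ks hk] := seq_argmax (fun j => `|x j|) s k0 k0s; exists k => j.
have [/hk //|js] := boolP (j \in s).
have : `|x j| <= `|x k0| / 2 by rewrite leNgt; apply: contra js => /hs.
by have := hk _ k0s; lra.
Qed.

(** There are fewer linear conditions than coefficients, so the matrix of values has a nonzero left
    kernel. *)
Lemma exists_vanishing_combination N (u : nat -> I -> R) (s : seq I) :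
  (size s < N)%N -> exists c : nat -> R, (exists2 i, (i < N)%N & c i != 0) /\
    forall k, k \in s -> \sum_(i < N) c i * u i k = 0.
Proof.
move=> sN; pose A := \matrix_(i < N, j < size s) u i (tnth (in_tuple s) j).
have : kermx A != 0.
  rewrite -mxrank_eq0 mxrank_ker subn_eq0 -ltnNge.
  exact: leq_ltn_trans (rank_leq_col _) sN.
case/rowV0Pn => d /sub_kermxP dA d0.
(* The kernel vector is extended by 0 to the indices from [N] on. *)
exists (fun i => if insub i is Some o then d 0 o else 0); split.
  case/rV0Pn: d0 => i di; exists (val i); rewrite ?ltn_ord //.
  by case: insubP => [j0 _ /val_inj ->|]; rewrite ?ltn_ord.
move=> k ks; have /tnthP[j kj] : k \in in_tuple s by [].
have := congr1 (fun B : 'rV_(size s) => B 0 j) dA; rewrite mxE [RHS]mxE; apply: etrans.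
apply: eq_bigr => i _; rewrite mxE -kj.
by case: insubP => [j0 _ /val_inj ->|]; rewrite ?ltn_ord.
Qed.

(* Milman's lemma. From a flat [x] of sup norm 1, move along a [y] in the span
   which vanishes where the maximum is already attained, until a new coordinate
   reaches 1: this happens first where [|y k| / (1 - |x k|)] is maximal. *)
Lemma exists_flat_combination N (u : nat -> I -> R) (q : seq I) M :
  (forall i, (i < N)%N -> vanishing (u i)) ->
  (forall c : nat -> R, (forall k, \sum_(i < N) c i * u i k = 0) ->
     forall i, (i < N)%N -> c i = 0) ->
  (size q + M <= N)%N ->
  exists c : nat -> R,
    [/\ forall k, `|\sum_(i < N) c i * u i k| <= 1,
        forall k, k \in q -> \sum_(i < N) c i * u i k = 0 &
        exists s, [/\ uniq s, size s = M &
          forall k, k \in s -> `|\sum_(i < N) c i * u i k| = 1]].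
Proof.
move=> vu indep; elim: M => [|M IH] qM.
  exists (fun=> 0); have z k : \sum_(i < N) 0 * u i k = 0.
    by apply: big1 => i _; rewrite mul0r.
  split=> [k|k _|]; [by rewrite z normr0 ler01|exact: z|by exists [::]].
have [|c [x1 xq [s [us ss xs]]]] := IH; first by move: qM; rewrite addnS => /ltnW.
set x := fun k => \sum_(i < N) c i * u i k.
(* If modulus 1 is already attained outside [s], the same combination serves; otherwise [|x k| < 1]
   off [s]. *)
have [[k ks xk]|H] := pselect (exists2 k, k \notin s & `|x k| = 1).
  exists c; split=> //; exists (k :: s); split=> /=; rewrite ?ks ?us ?ss //.
  by move=> j; rewrite inE => /predU1P[->|/xs].
have [|d [[i0 iN di] yqs]] := exists_vanishing_combination N u (q ++ s).
  by rewrite size_cat ss -ltnS -addnS.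
set y := fun k => \sum_(i < N) d i * u i k in yqs.
have [k0 yk0] : exists k, y k != 0.
  apply: contrapT => /forallNP y0; move/eqP: di; apply; apply: (indep d) => // k.
  by apply/eqP/negP => /negP /y0.
have ys k : k \in s -> y k = 0 by move=> ks; apply: yqs; rewrite mem_cat ks orbT.
have xlt k : k \notin s -> `|x k| < 1.
  by move=> ks; rewrite lt_neqAle x1 andbT; apply/eqP => xk; apply: H; exists k.
(* Off [s], moving by [t] keeps coordinate [k] within 1 as long as [|t| * r k <= 1]. On [s] the
   denominator is 0, but so is [y k], and the quotient is 0. *)
pose r k := `|y k| / (1 - `|x k|).
have r0 k : 0 <= r k by rewrite divr_ge0 // subr_ge0 x1.
have vr : vanishing r.
  move=> e e0; have [|s1 h1] := vanishing_sum N d u vu (e / 2); first by lra.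
  have [|s2 h2] := vanishing_sum N c u vu (1 / 2); first by lra.
  exists (s1 ++ s2) => k ek; rewrite mem_cat; apply: contraTT ek.
  rewrite negb_or => /andP[k1 k2]; rewrite -leNgt (ger0_norm (r0 k)).
  have yk : `|y k| <= e / 2 by rewrite leNgt; apply: contra k1 => /h1.
  have xk : `|x k| <= 1 / 2 by rewrite leNgt; apply: contra k2 => /h2.
  rewrite ler_pdivrMr; last by lra.
  by nra.
have k0s : k0 \notin s by apply: contra yk0 => /ys ->.
have [|k hk] := vanishing_argmax r k0 vr.
  by rewrite normr_gt0 mulf_neq0 ?normr_eq0 // invr_eq0 gt_eqF // subr_gt0 xlt.
have rk : 0 < r k.
  rewrite -[r k]ger0_norm //; apply: lt_le_trans (hk k0).
  by rewrite normr_gt0 mulf_neq0 ?normr_eq0 // invr_eq0 gt_eqF // subr_gt0 xlt.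
have ks : k \notin s by apply: contraTN rk => /ys yk; rewrite /r yk normr0 mul0r ltxx.
(* The sign of [t] makes [x k] and [t * y k] agree in sign, so that the modulus at the maximizer [k]
   reaches exactly 1. *)
have [t tr xyk] : exists2 t, `|t| = (r k)^-1 & `|x k + t * y k| = `|x k| + `|t * y k|.
  have ri : 0 < (r k)^-1 by rewrite invr_gt0.
  have [xy|/ltW xy] := leP 0 (x k * y k).
    exists (r k)^-1; first by rewrite ger0_norm ?ltW.
    by apply: same_sign_normrD; rewrite mulrCA mulr_ge0 // ltW.
  exists (- (r k)^-1); first by rewrite normrN ger0_norm ?ltW.
  by apply: same_sign_normrD; rewrite mulrCA mulr_le0 // oppr_le0 ltW.
have hk' j : `|x j + t * y j| <= 1.
  apply: le_trans (ler_normD _ _) _; rewrite normrM tr.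
  have [js|js] := boolP (j \in s); first by rewrite ys // normr0 mulr0 addr0 x1.
  have := hk j; rewrite (ger0_norm (r0 j)) (ger0_norm (r0 k)) {1}/r.
  rewrite ler_pdivrMr ?subr_gt0 ?xlt // => yj.
  by rewrite mulrC -lerBrDl ler_pdivrMr // mulrC.
have comb j : \sum_(i < N) (c i + t * d i) * u i j = x j + t * y j.
  by rewrite mulr_sumr -big_split; apply: eq_bigr => i _; rewrite mulrDl mulrA.
exists (fun i => c i + t * d i); split=> [j|j jq|].
- by rewrite comb.
- by rewrite comb [x j]xq // [y j]yqs ?mulr0 ?addr0 // mem_cat jq.
exists (k :: s); split=> /=; rewrite ?ks ?us ?ss // => j.
rewrite comb inE => /predU1P[->|js]; last by rewrite ys // mulr0 addr0 [LHS]xs.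
rewrite xyk normrM tr /r invf_div -mulrA mulVf ?mulr1 ?subrKC // normr_eq0.
by apply: contraTN rk => /eqP yk; rewrite /r yk normr0 mul0r ltxx.
Qed.

End FlatVectors.

(** * Lorentz and l_p norms as suprema of weighted sums *)

Section Rearrangement.
Context {R : realType} (p : R).
Hypothesis hp : 1 <= p.

Lemma c0_vanishing (x : nat -> R) : c0 x <-> vanishing x.
Proof.
split=> [/cvgr0Pnorm_le xc e e0|vx].
  have [n _ hn] := xc e e0; exists (iota 0 n) => k; rewrite mem_iota add0n.
  by apply: contraTT; rewrite -leqNgt => /hn /=; rewrite -leNgt.
apply/cvgr0Pnorm_le => e e0; have [s hs] := vx e e0.
exists (\max_(i <- s) i).+1 => //= k; rewrite leNgt => sk; apply/negP => /hs ks.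
have := @leq_bigmax_seq _ s xpredT id k ks isT; by rewrite leqNgt sk.
Qed.

Section FixedSequence.
Variable x : nat -> R.
Hypothesis vx : vanishing x.

Lemma xstar_le t (s : seq nat) n : 0 <= t -> (size s <= n)%N ->
  (forall k, t < `|x k| -> k \in s) -> xstar x n <= t.
Proof.
move=> t0 sn H; apply: ge_inf; first by exists 0 => u [].
by split=> //; exists s.
Qed.

Lemma le_xstar a n (s : seq nat) : uniq s -> size s = n.+1 ->
  (forall k, k \in s -> a <= `|x k|) -> a <= xstar x n.
Proof.
move=> us sn H; apply: lb_le_inf.
  (* This bound on all [|x k|], with the empty list, shows that the set defining [xstar] is
     nonempty. *)
  have [s1 h1] := vx 1 ltr01; exists (1 + \sum_(k <- s1) `|x k|); split.
    by rewrite addr_ge0 ?sumr_ge0.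
  exists [::]; split=> // k xk; suff : `|x k| <= 1 + \sum_(k <- s1) `|x k| by lra.
  have S0 : 0 <= \sum_(k <- s1) `|x k| by rewrite sumr_ge0.
  have [ks|/negP ks] := boolP (k \in s1); last first.
    by have : `|x k| <= 1 by [rewrite leNgt; apply/negP => /h1]; lra.
  rewrite (big_rem k) //=.
  have : 0 <= \sum_(k <- rem k s1) `|x k| by rewrite sumr_ge0.
  by lra.
move=> t [t0 [s1 [ss1 h1]]]; rewrite leNgt; apply/negP => ta.
have : (size s <= size s1)%N.
  by apply: uniq_leq_size => // k /H ak; apply: h1; exact: lt_le_trans ak.
by rewrite sn ltnNge ss1.
Qed.

Lemma xstar_ge0 n : 0 <= xstar x n.
Proof. by apply: (le_xstar _ _ (iota 0 n.+1)); rewrite ?iota_uniq ?size_iota. Qed.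

(** Gives the greedy choice of a next largest coordinate. If [x] is zero off [s], any index outside
    [s] serves; otherwise the maximum of [x] with [s] erased is taken. *)
Lemma exists_argmax_outside (s : seq nat) :
  exists2 k, k \notin s & forall j, j \notin s -> `|x j| <= `|x k|.
Proof.
have [[k0 ks xk0]|H] := pselect (exists2 k, k \notin s & x k != 0); last first.
  exists (\max_(i <- s) i).+1.
    apply/negP => ks; have := @leq_bigmax_seq _ s xpredT id _ ks isT.
    by rewrite ltnn.
  move=> j js; have [->|xj] := eqVneq (x j) 0; first by rewrite normr0.
  by case: H; exists j.
pose y k := if k \in s then 0 else x k.
have [||k hk] := @vanishing_argmax _ _ y k0.
- move=> e e0; have [t ht] := vx e e0; exists t => k; rewrite /y.
  by case: ifP => _; [rewrite normr0 ltNge ltW|exact: ht].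
- by rewrite /y (negbTE ks) normr_gt0.
have ks' : k \notin s.
  apply/negP => ks'; have := hk k0; rewrite /y (negbTE ks) ks' normr0.
  by rewrite normr_le0 (negbTE xk0).
exists k => // j js; by have := hk j; rewrite /y (negbTE js) (negbTE ks').
Qed.

Section Weight.
Variable w : nat -> R.
Hypothesis w0 : forall n, 0 <= w n.
Hypothesis wdec : forall m n, (m <= n)%N -> w n <= w m.

(** Each greedily chosen [k] dominates all coordinates not yet listed, so only the [n] listed ones
    can exceed [|x k|], and [xstar x n <= |x k|]. *)
Lemma sum_xstar_le_wsum n : exists2 s, uniq s &
  \sum_(0 <= i < n) w i * xstar x i `^ p <= wsum p w x 0 s.
Proof.
suff [s us [_ h]] : exists2 s, uniq s &
    size s = n /\ \sum_(0 <= i < n) w i * xstar x i `^ p <= wsum p w x 0 s by exists s.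
elim: n => [|n [s us [ss IH]]]; first by exists [::]; rewrite ?big_nil.
have [k ks hk] := exists_argmax_outside s.
exists (rcons s k); rewrite ?rcons_uniq ?us ?ks ?size_rcons ?ss //; split=> //.
rewrite -cats1 wsum_cat big_nat_recr //= addr0 ss lerD // ler_wpM2l //.
rewrite -(ger0_norm (xstar_ge0 n)); apply: norm_powR_le => //.
rewrite (ger0_norm (xstar_ge0 n)); apply: (xstar_le _ s); rewrite ?ss //.
by move=> j; apply: contraTT => /hk; rewrite -leNgt.
Qed.

(** A rearrangement inequality by adjacent swaps: moving the smaller entry one place to the right
    changes the sum by a product of two nonnegative differences. *)
Lemma wsum_move_last i k s : (forall j, j \in s -> `|x i| <= `|x j|) ->
  wsum p w x k (i :: s) <= wsum p w x k s + w (k + size s)%N * `|x i| `^ p.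
Proof.
elim: s k => [|j s IH] k H /=; first by rewrite addn0 addr0 add0r.
have /= := IH k.+1 (fun j' js => H j' (@mem_behead _ (j :: s) j' js)).
have := norm_powR_le _ hp _ _ (H j (mem_head _ _)).
by have := wdec _ _ (leqnSn k); rewrite addnS addSn; nra.
Qed.

(** A smallest entry is moved to the last place; since all [n + 1] entries are at least as large, it
    is at most [xstar x n]. Induction treats the others. *)
Lemma wsum_le_sum_xstar s : uniq s ->
  wsum p w x 0 s <= \sum_(0 <= i < size s) w i * xstar x i `^ p.
Proof.
move: {2}(size s) (erefl (size s)) => n; elim: n s => [|n IH] s.
  by move=> /size0nil -> _; rewrite big_nil.
case: s => // i0 s0; set s := i0 :: s0 => ss us.
have [i si hi] := seq_argmax (fun k => - `|x k|) s i0 (mem_head _ _).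
have [s1 [s2 es]] : exists s1 s2, s = s1 ++ i :: s2.
  by case/path.splitPr: si => s1 s2; exists s1, s2.
rewrite es in ss us hi *.
have {}hi j : j \in s1 ++ i :: s2 -> `|x i| <= `|x j| by move/hi; rewrite lerN2.
have us12 : uniq (s1 ++ s2).
  by move: us; rewrite -cat1s uniq_catCA cat1s => /andP[].
have ss12 : size (s1 ++ s2) = n by move: ss; rewrite !size_cat /= addnS => -[].
have := IH _ ss12 us12; rewrite ss12 ss big_nat_recr //= => h.
apply: le_trans (_ : wsum p w x 0 (s1 ++ s2) + w n * `|x i| `^ p <= _).
  rewrite -ss12 size_cat !wsum_cat -addrA lerD2l add0n; apply: wsum_move_last.
  by move=> j js; apply: hi; rewrite mem_cat inE js !orbT.
apply: lerD => //; rewrite ler_wpM2l // -(ger0_norm (xstar_ge0 n)).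
by apply: norm_powR_le => //; rewrite (ger0_norm (xstar_ge0 n)); exact: (le_xstar _ _ _ us).
Qed.

End Weight.
End FixedSequence.

(** Covers d_{w,p} and, with constant weight 1, l_p, so that one argument treats both kinds of
    domain. *)
Definition is_lorentz_norm (w x : nat -> R) (a : R) :=
  [/\ 0 <= a, dominated p w x (a `^ p) & forall c, dominated p w x c -> a `^ p <= c].

Lemma powR_inv_powR (a : R) : 0 <= a -> (a `^ p^-1) `^ p = a.
Proof. by move=> a0; rewrite -powRrM mulVf ?exponent_neq0 // powRr1. Qed.

Section NonnegativeSeries.
Variable a : nat -> R.
Hypothesis a0 : forall n, 0 <= a n.

Lemma nonneg_series_le_lim n : cvgn (series a) -> \sum_(0 <= i < n) a i <= limn (series a).
Proof.
move=> ca; apply: (nondecreasing_cvgn_le _ ca n).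
by apply: nondecreasing_series => i _ _.
Qed.

Lemma bounded_nonneg_series c : (forall n, \sum_(0 <= i < n) a i <= c) ->
  cvgn (series a) /\ limn (series a) <= c.
Proof.
move=> ac; have ca : cvgn (series a).
  apply: nondecreasing_is_cvgn; first by apply: nondecreasing_series => i _ _.
  by exists c => _ [n _ <-]; exact: ac.
by split=> //; apply: limr_le => //; near=> n; exact: ac.
Unshelve. all: by end_near. Qed.

End NonnegativeSeries.

Section Lorentz.
Variable w : nat -> R.
Hypothesis w0 : forall n, 0 <= w n.
Hypothesis wdec : forall m n, (m <= n)%N -> w n <= w m.
Hypothesis winf : series w n @[n --> \oo] --> +oo.

Lemma xstar_term_ge0 (x : nat -> R) n : 0 <= w n * xstar x n `^ p.
Proof. by rewrite mulr_ge0 ?powR_ge0. Qed.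

Lemma dominated_dwp x c : dominated p w x c -> dwp w p x.
Proof.
move=> xc; have vx : vanishing x.
  by move=> e; exact: (dominated_c0 _ hp _ w0 winf _ _ _ xc).
split; first exact/c0_vanishing.
have [] // := bounded_nonneg_series _ (xstar_term_ge0 x) c.
move=> n; have [s us h] := sum_xstar_le_wsum _ vx _ w0 n.
by apply: le_trans h (xc s us).
Qed.

Lemma dnorm_is_lorentz_norm x : dwp w p x -> is_lorentz_norm w x (dnorm w p x).
Proof.
move=> [/c0_vanishing vx cx]; rewrite /dnorm.
have l0 : 0 <= limn (series (fun n => w n * xstar x n `^ p)).
  by have := nonneg_series_le_lim _ (xstar_term_ge0 x) 0 cx; rewrite big_nil.
split; rewrite ?powR_ge0 // powR_inv_powR //.
  move=> s us; apply: le_trans (wsum_le_sum_xstar _ vx _ w0 wdec s us) _.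
  exact: nonneg_series_le_lim _ (xstar_term_ge0 x) _ _.
move=> c xc; have [] // := bounded_nonneg_series _ (xstar_term_ge0 x) c.
move=> n; have [s us h] := sum_xstar_le_wsum _ vx _ w0 n.
by apply: le_trans h (xc s us).
Qed.

End Lorentz.

(** * The space l_p as the case of constant weight 1 *)

Lemma lp_terms_ge0 (x : nat -> R) n : 0 <= `|x n| `^ p.
Proof. exact: powR_ge0. Qed.

Lemma wsum1_iota (x : nat -> R) n :
  wsum p (fun=> 1) x 0 (iota 0 n) = \sum_(0 <= i < n) `|x i| `^ p.
Proof. by rewrite wsum_iota; apply: eq_bigr => i _; rewrite mul1r. Qed.

Lemma dominated_lp x c : dominated p (fun=> 1) x c -> lp p x.
Proof.
move=> xc; have [] // := bounded_nonneg_series _ (lp_terms_ge0 x) c.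
by move=> n; rewrite -wsum1_iota; apply: xc; rewrite iota_uniq.
Qed.

(** With constant weight the order of the list is immaterial, so its sum is part of an initial
    sum. *)
Lemma wsum1_le_sum (x : nat -> R) (s : seq nat) : uniq s ->
  wsum p (fun=> 1) x 0 s <= \sum_(0 <= i < (\max_(i <- s) i).+1) `|x i| `^ p.
Proof.
move=> us; have E k t : wsum p (fun=> 1) x k t = \sum_(i <- t) `|x i| `^ p.
  by elim: t k => [|i t IH] k /=; rewrite ?big_nil ?big_cons // mul1r IH.
have ps : perm_eq [seq i <- index_iota 0 (\max_(i <- s) i).+1 | i \in s] s.
  apply: uniq_perm; rewrite ?filter_uniq ?iota_uniq // => i.
  rewrite mem_filter mem_index_iota /=; case: (boolP (i \in s)) => //= si.
  by rewrite ltnS; exact: (@leq_bigmax_seq _ _ xpredT id).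
rewrite E -(perm_big _ ps) big_filter.
by rewrite [X in _ <= X](bigID (mem s)) /= lerDl sumr_ge0 // => i _; exact: powR_ge0.
Qed.

Lemma lpnorm_is_lorentz_norm x : lp p x -> is_lorentz_norm (fun=> 1) x (lpnorm p x).
Proof.
move=> cx; rewrite /lpnorm.
have l0 : 0 <= limn (series (fun n => `|x n| `^ p)).
  by have := nonneg_series_le_lim _ (lp_terms_ge0 x) 0 cx; rewrite big_nil.
split; rewrite ?powR_ge0 // powR_inv_powR //.
  move=> s us; apply: le_trans (wsum1_le_sum x s us) _.
  exact: nonneg_series_le_lim _ (lp_terms_ge0 x) _ _.
move=> c xc; have [] // := bounded_nonneg_series _ (lp_terms_ge0 x) c.
by move=> n; rewrite -wsum1_iota; apply: xc; rewrite iota_uniq.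
Qed.

End Rearrangement.

(** * Upper and lower l_p estimates for almost disjoint sequences *)

Section Blocks.
Context {R : realType} (p : R).
Hypothesis hp : 1 <= p.
Variable w : nat -> R.
Hypothesis w0 : forall n, 0 <= w n.

Lemma head_tail m (x : nat -> R) k : head_upto m x k + tail_from m x k = x k.
Proof. by rewrite /head_upto /tail_from; case: ifP; rewrite ?addr0 ?add0r. Qed.

Lemma dominated_head m x c : dominated p w x c -> dominated p w (head_upto m x) c.
Proof.
apply: dominated_le => // i; rewrite /head_upto.
by case: ifP => _; rewrite ?normr0 ?normr_ge0.
Qed.

(** Iterating the quasi-triangle inequality costs one more factor [2^p] for each term; this dictates
    how fast the tails must decrease. *)
Lemma wsum_sum n (u : nat -> nat -> R) k s :
  wsum p w (fun i => \sum_(j < n) u j i) k s <=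
  \sum_(j < n) (2 `^ p) ^+ j.+1 * wsum p w (u j) k s.
Proof.
elim: n u => [|n IH] u.
  rewrite big_ord0 (eq_wsum _ _ _ (fun i => 0 * u 0%N i)).
    by rewrite wsumZ // normr0 powR0 ?mul0r // exponent_neq0.
  by move=> i _; rewrite big_ord0 mul0r.
rewrite (eq_wsum _ _ _ (fun i => u 0%N i + \sum_(j < n) u j.+1 i)); last first.
  by move=> i _; rewrite big_ord_recl.
apply: le_trans (wsumD _ hp _ w0 _ _ _ _) _.
rewrite big_ord_recl mulrDr expr1 lerD2l.
apply: le_trans (ler_wpM2l _ (IH (fun j => u j.+1))) _; first exact: powR_ge0.
by rewrite mulr_sumr; apply: ler_sum => i _; rewrite mulrA -exprS.
Qed.

Variables (m : nat -> nat) (y : nat -> nat -> R).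
Hypothesis m_mono : forall n, (m n <= m n.+1)%N.
Hypothesis y_before : forall n k, (k < m n)%N -> y n k = 0.

(** The combination splits into blocks supported on the disjoint intervals from [m j] to [m j.+1],
    and a small perturbation. *)
Let heads (a : nat -> R) n k := \sum_(j < n) a j * head_upto (m j.+1) (y j) k.
Let tails (a : nat -> R) n k := \sum_(j < n) a j * tail_from (m j.+1) (y j) k.

Implicit Types (a : nat -> R) (n : nat).

Lemma m_homo i j : (i <= j)%N -> (m i <= m j)%N.
Proof. exact: (homo_leq (@leqnn) (@leq_trans) m_mono). Qed.

Lemma heads_eq0 a n k : (m n <= k)%N -> heads a n k = 0.
Proof.
move=> mk; apply: big1 => j _; rewrite /head_upto ifF ?mulr0 //.
by apply/negbTE; rewrite -leqNgt (leq_trans _ mk) // m_homo // ltn_ord.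
Qed.

Lemma head_block_eq0 n k : (k < m n)%N -> head_upto (m n.+1) (y n) k = 0.
Proof. by move=> km; rewrite /head_upto y_before // if_same. Qed.

Lemma heads_tails a n k :
  \sum_(j < n) a j * y j k = heads a n k + tails a n k.
Proof.
by rewrite -big_split; apply: eq_bigr => j _; rewrite /= -mulrDr head_tail.
Qed.

(** Disjoint supports make every weighted sum additive over the blocks, so no power of [2^p]
    accumulates. *)
Lemma dominated_heads c a n : (forall j, dominated p w (y j) c) ->
  dominated p w (heads a n) (c * \sum_(j < n) `|a j| `^ p).
Proof.
move=> yc s us; elim: n => [|n IH].
  rewrite big_ord0 mulr0 (eq_wsum _ _ _ (fun i => 0 * y 0%N i)).
    by rewrite wsumZ // normr0 powR0 ?mul0r // exponent_neq0.
  by move=> i _; rewrite /heads big_ord0 mul0r.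
rewrite (eq_wsum _ _ _ (fun i => heads a n i + a n * head_upto (m n.+1) (y n) i)).
  rewrite wsum_disjointD //; last first.
    move=> i; have [mi|mi] := leqP (m n) i; first by left; exact: heads_eq0.
    by right; rewrite head_block_eq0 ?mulr0.
  rewrite big_ord_recr mulrDr lerD // wsumZ // mulrC ler_wpM2r ?powR_ge0 //.
  exact: dominated_head.
by move=> i _; rewrite /heads big_ord_recr.
Qed.

(** The denominators cancel the factors coming from [wsum_sum]. *)
Lemma dominated_tails eta a n :
  (forall j, dominated p w (tail_from (m j.+1) (y j)) (eta / (2 `^ p) ^+ j.+1)) ->
  dominated p w (tails a n) (eta * \sum_(j < n) `|a j| `^ p).
Proof.
move=> ye s us.
apply: le_trans (wsum_sum n (fun j k => a j * tail_from (m j.+1) (y j) k) 0 s) _.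
rewrite mulr_sumr; apply: ler_sum => j _; rewrite wsumZ // mulrCA mulrC.
rewrite ler_wpM2r ?powR_ge0 // mulrC -ler_pdivlMr ?exprn_gt0 ?powR_gt0 //.
exact: ye.
Qed.

Lemma dominated_blocks eta a n : (forall j, dominated p w (y j) 1) ->
  (forall j, dominated p w (tail_from (m j.+1) (y j)) (eta / (2 `^ p) ^+ j.+1)) ->
  dominated p w (fun k => \sum_(j < n) a j * y j k)
    (2 `^ p * (1 + eta) * \sum_(j < n) `|a j| `^ p).
Proof.
move=> y1 ye; under eq_fun do rewrite heads_tails.
rewrite -mulrA mulrDl; apply: dominatedD => //; first exact: dominated_heads.
exact: dominated_tails.
Qed.

Section LowerEstimate.
Variables (L : nat -> nat) (kappa : R).
Hypothesis L0 : L 0%N = 0%N.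
Hypothesis y_mass : forall n, exists t,
  [/\ uniq t, forall k, k \in t -> (m n <= k < m n.+1)%N, (L n + size t)%N = L n.+1 &
      kappa <= wsum p w (y n) (L n) t].

(** The lists given by [y_mass] are concatenated: the [n]-th one starts at position [L n], exactly
    where its mass was measured, and distinct lists do not meet. *)
Lemma wsum_heads_ge a n : exists s,
  [/\ uniq s, forall k, k \in s -> (k < m n)%N, size s = L n &
      kappa * \sum_(j < n) `|a j| `^ p <= wsum p w (heads a n) 0 s].
Proof.
elim: n => [|n [s [us sm ss hs]]]; first by exists [::]; rewrite big_ord0 mulr0 L0.
have [t [ut tm tL ht]] := y_mass n; exists (s ++ t); split.
- rewrite cat_uniq us ut andbT /=; apply/hasPn => k /tm /andP[mk _] /=.
  by apply/negP => /sm; rewrite ltnNge mk.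
- move=> k; rewrite mem_cat => /orP[/sm km|/tm/andP[]//].
  exact: leq_trans km (m_mono n).
- by rewrite size_cat ss.
rewrite wsum_cat ss add0n big_ord_recr mulrDr; apply: lerD.
  apply: le_trans hs _; rewrite le_eqVlt; apply/orP; left; apply/eqP.
  by apply: eq_wsum => k /sm km; rewrite /heads big_ord_recr /= head_block_eq0 // mulr0 addr0.
rewrite (eq_wsum _ _ _ (fun k => a n * y n k)).
  by rewrite wsumZ // mulrC ler_wpM2l ?powR_ge0.
move=> k /tm /andP[mk km]; rewrite /heads big_ord_recr /= -/(heads a n k) heads_eq0 //.
by rewrite add0r /head_upto km.
Qed.

(** The heads are the full combination plus the tails with opposite coefficients. The [eta] term is
    to be absorbed on the left. *)
Lemma blocks_lower_estimate eta c a n :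
  (forall j, dominated p w (tail_from (m j.+1) (y j)) (eta / (2 `^ p) ^+ j.+1)) ->
  dominated p w (fun k => \sum_(j < n) a j * y j k) c ->
  kappa * \sum_(j < n) `|a j| `^ p <=
    2 `^ p * (c + eta * \sum_(j < n) `|a j| `^ p).
Proof.
move=> ye yc; have [s [us _ _ hs]] := wsum_heads_ge a n.
apply: le_trans hs _.
rewrite (eq_wsum _ _ _ (fun k => \sum_(j < n) a j * y j k + tails (fun j => - a j) n k)).
  apply: le_trans (wsumD _ hp _ w0 _ _ _ _) _; rewrite ler_wpM2l ?powR_ge0 // lerD ?yc //.
  have := dominated_tails eta (fun j => - a j) n ye s us.
  by under eq_bigr do rewrite normrN.
move=> k _; rewrite heads_tails -addrA /tails -big_split big1 ?addr0 // => j _.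
by rewrite /= mulNr subrr.
Qed.

End LowerEstimate.
End Blocks.

(** * Operators bounded below on large finite-dimensional subspaces *)

Section Operators.
Context {R : realType} (p : R).
Hypothesis hp : 1 <= p.
Let hp0 : 0 < p := exponent_gt0 p hp.

Lemma powR_le_cancel (a b : R) : 0 <= a -> 0 <= b -> a `^ p <= b `^ p -> a <= b.
Proof.
move=> a0 b0; apply: contraTT; rewrite -!ltNge => ba.
by apply: gt0_ltr_powR.
Qed.

Lemma powR_le (a b : R) : 0 <= a -> a <= b -> a `^ p <= b `^ p.
Proof.
by move=> a0 ab; apply: ge0_ler_powR; rewrite ?nnegrE ?(le_trans a0 ab) // ltW.
Qed.

Lemma subspace_sum (S : set (nat -> R)) N (c : nat -> R) u : is_subspace S ->
  (forall i, (i < N)%N -> S (u i)) -> S (fun k => \sum_(i < N) c i * u i k).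
Proof.
move=> [S0 [SD SZ]]; elim: N => [|N IH] Su.
  by rewrite (_ : (fun _ => _) = fun=> 0) //; apply/funext => k; rewrite big_ord0.
rewrite (_ : (fun _ => _) = fun k => \sum_(i < N) c i * u i k + c N * u N k); last first.
  by apply/funext => k; rewrite big_ord_recr.
by apply: SD (SZ (c N) _ (Su N (ltnSn N))); apply: IH => i /ltnW; exact: Su.
Qed.

Variables v w : nat -> R.
Hypotheses (v0 : forall n, 0 <= v n) (w0 : forall n, 0 <= w n).
Hypotheses (vdec : forall m n, (m <= n)%N -> v n <= v m)
           (wdec : forall m n, (m <= n)%N -> w n <= w m).
Hypotheses (vinf : series v n @[n --> \oo] --> +oo)
           (winf : series w n @[n --> \oo] --> +oo).
Variables (X : set (nat -> R)) (nX nY : (nat -> R) -> R) (T : (nat -> R) -> nat -> R).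
Hypothesis X_subspace : is_subspace X.
Hypothesis nX_norm : forall x, X x -> is_lorentz_norm p v x (nX x).
Hypothesis nY_norm : forall x, X x -> is_lorentz_norm p w (T x) (nY (T x)).
Hypothesis T_add : forall x y, X x -> X y ->
  T (fun k => x k + y k) = (fun k => T x k + T y k).
Hypothesis T_scale : forall a x, X x -> T (fun k => a * x k) = (fun k => a * T x k).
Variable C : R.
Hypothesis T_bounded : forall x, X x -> nY (T x) <= C * nX x.

Lemma T_sum N (c : nat -> R) u : (forall i, (i < N)%N -> X (u i)) ->
  T (fun k => \sum_(i < N) c i * u i k) = fun k => \sum_(i < N) c i * T (u i) k.
Proof.
elim: N => [|N IH] Xu.
  have X0 := X_subspace.1.
  rewrite (_ : (fun _ => _) = fun k : nat => 0 * ((fun=> 0) : nat -> R) k).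
    by rewrite T_scale //; apply/funext => k; rewrite big_ord0 mul0r.
  by apply/funext => k; rewrite big_ord0 mul0r.
have Xu' i : (i < N)%N -> X (u i) by move/ltnW; exact: Xu.
rewrite (_ : (fun _ => _) = fun k => \sum_(i < N) c i * u i k + c N * u N k); last first.
  by apply/funext => k; rewrite big_ord_recr.
have XN : X (u N) by exact: Xu.
rewrite T_add ?IH ?T_scale //; first by apply/funext => k; rewrite big_ord_recr.
  exact: (subspace_sum X).
by have [_ [_ XZ]] := X_subspace; exact: XZ.
Qed.

Lemma T_bounded_pos : exists2 D, 1 <= D & forall x, X x -> nY (T x) <= D * nX x.
Proof.
exists (1 + `|C|) => [|x Xx]; first by rewrite lerDl.
have [a0 _ _] := nX_norm _ Xx; apply: le_trans (T_bounded _ Xx) _.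
by apply: ler_wpM2r => //; have := ler_norm C; lra.
Qed.

Section BoundedBelow.
Variable eps : R.
Hypothesis eps0 : 0 < eps.
Hypothesis not_fss : forall N, exists Z, [/\ Z `<=` X, is_subspace Z, dim_ge N Z &
  forall z, Z z -> eps * nX z <= nY (T z)].

Let inlo (k : nat + nat) := if k is inl i then Some i else None.
Let inro (k : nat + nat) := if k is inr i then Some i else None.

(** A combination flat at [M + M] coordinates of the graph has [M] of them in [z] or [M] in [T z].
    Either case gives [nX z >= 1 / d], directly or through boundedness of [T], so normalization
    brings the sup norm of [T z] below [d]. *)
Lemma exists_spread_vector d m : 0 < d -> exists z,
  [/\ X z, dominated p v z 1, forall k, (k < m)%N -> z k = 0 /\ T z k = 0,
      forall k, `|T z k| <= d &
      exists2 s, uniq s & eps `^ p / 2 < wsum p w (T z) 0 s].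
Proof.
move=> d0; have [D D1 TD] := T_bounded_pos.
have D0 : 0 < D by lra.
(* In either space, [M] coordinates of modulus 1 will force norm at least [D / d]. *)
have [M1 hM1] := sum_weight_large v vinf ((D / d) `^ p).
have [M2 hM2] := sum_weight_large w winf ((D / d) `^ p).
pose M := maxn M1 M2.
have {}hM1 : (D / d) `^ p <= \sum_(0 <= i < M) v i.
  by apply: le_trans hM1 _; rewrite sum_weight_le // leq_maxl.
have {}hM2 : (D / d) `^ p <= \sum_(0 <= i < M) w i.
  by apply: le_trans hM2 _; rewrite sum_weight_le // leq_maxr.
(* Vanishing on [q] makes both [z] and [T z] zero on the first [m] coordinates. *)
pose q : seq (nat + nat) := map inl (iota 0 m) ++ map inr (iota 0 m).
pose N := (size q + (M + M))%N.
have [Z [ZX Zsub [e [Ze eindep]] Zbelow]] := not_fss N.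
have Xe i : (i < N)%N -> X (e i) by move/Ze/ZX.
(* Milman's lemma is applied to the graph of [T], so as to control the sup norms
   of a vector and of its image at once. *)
pose u i (k : nat + nat) := match k with inl j => e i j | inr j => T (e i) j end.
have [|||c [u1 uq [s [us ss su]]]] := exists_flat_combination N u q (M + M).
- move=> i iN.
  have [_ he _] := nX_norm _ (Xe i iN); have [_ hTe _] := nY_norm _ (Xe i iN).
  move=> t t0; have [s1 h1] := dominated_c0 _ hp _ v0 vinf _ _ _ he t0.
  have [s2 h2] := dominated_c0 _ hp _ w0 winf _ _ _ hTe t0.
  exists (map inl s1 ++ map inr s2) => -[k|k] /= tk; rewrite mem_cat.
    by rewrite map_f // h1.
  by rewrite orbC map_f // h2.
- by move=> c hc; apply: eindep => k; exact: (hc (inl k)).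
- by [].
pose z := fun k => \sum_(i < N) c i * e i k.
have Zz : Z z by exact: (subspace_sum Z).
have Xz : X z by exact: ZX.
have Tz : T z = fun k => \sum_(i < N) c i * T (e i) k by exact: T_sum.
have [a0 dz lz] := nX_norm _ Xz; have [b0 dTz lTz] := nY_norm _ Xz.
set a := nX z in a0 dz lz.
have ad : 1 / d <= a.
  have sz : (size (pmap inlo s) + size (pmap inro s) = M + M)%N.
    by rewrite -ss; elim: (s) => //= -[k|k] s' <-; rewrite ?addSn ?addnS.
  have [Ml|Mr] : (M <= size (pmap inlo s))%N \/ (M <= size (pmap inro s))%N by lia.
  - have ul : uniq (pmap inlo s) by apply: (@pmap_uniq _ _ inlo inl) => // -[].
    apply: le_trans (_ : D / d <= _); first by rewrite ler_pM2r ?invr_gt0.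
    apply: powR_le_cancel => //; first by rewrite divr_ge0 // ltW.
    apply: le_trans hM1 _; apply: le_trans (dz _ ul).
    rewrite (wsum_cst _ _ _ 1) //; last first.
      by move=> i; rewrite mem_pmap => /mapP[[j|//] js [->]]; exact: (su (inl j)).
    by rewrite powR1 mul1r add0n; exact: sum_weight_le.
  - have ul : uniq (pmap inro s) by apply: (@pmap_uniq _ _ inro inr) => // -[].
    have : D / d <= nY (T z).
      apply: powR_le_cancel => //; first by rewrite divr_ge0 // ltW.
      apply: le_trans hM2 _; apply: le_trans (dTz _ ul).
      rewrite (wsum_cst _ _ _ 1) //; last first.
        by move=> i; rewrite mem_pmap Tz => /mapP[[//|j] js [->]]; exact: (su (inr j)).
      by rewrite powR1 mul1r add0n; exact: sum_weight_le.
    move=> /le_trans/(_ (TD _ Xz)); rewrite ler_pM2l // => h.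
    by rewrite mul1r.
have a_gt0 : 0 < a by apply: lt_le_trans ad; rewrite divr_gt0.
have ia0 : 0 <= a^-1 by rewrite invr_ge0.
have iad : a^-1 <= d by rewrite -[d]invrK lef_pV2 ?posrE ?invr_gt0 // -[d^-1]mul1r.
have ap0 : 0 < a `^ p by rewrite powR_gt0.
have iap : `|a^-1| `^ p * a `^ p = 1.
  by rewrite -powRM ?normr_ge0 // ger0_norm // mulVf ?gt_eqF // powR1.
exists (fun k => a^-1 * z k); split.
- by have [_ [_ XZ]] := X_subspace; exact: XZ.
- by rewrite -iap; exact: dominatedZ.
- have hq k : (k < m)%N -> inl k \in q /\ inr k \in q.
    by move=> km; rewrite !mem_cat !map_f ?orbT // mem_iota.
  move=> k /hq[kl kr]; rewrite T_scale // Tz.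
  by rewrite /z (uq _ kl) (uq _ kr) mulr0.
- move=> k; rewrite T_scale // normrM (ger0_norm ia0) Tz.
  by apply: le_trans iad; rewrite ler_piMr //; exact: (u1 (inr k)).
(* Without such a list, half the p-th power of [eps * a] would dominate [T z], against the lower
   bound on [Z]. *)
have [s1 us1 hs1] : exists2 s, uniq s & eps `^ p / 2 * a `^ p < wsum p w (T z) 0 s.
  apply: contrapT => H.
  have : dominated p w (T z) (eps `^ p / 2 * a `^ p).
    by move=> s1 us1; rewrite leNgt; apply/negP => h; apply: H; exists s1.
  move/lTz; apply/negP; rewrite -ltNge.
  apply: lt_le_trans (_ : (eps * a) `^ p <= _).
    rewrite powRM // ?ltW // ltr_pM2r // ltr_pdivrMr //.
    by have := powR_gt0 p eps0; lra.
  by apply: powR_le; [rewrite mulr_ge0 // ltW|exact: Zbelow].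
exists s1 => //; rewrite T_scale // wsumZ.
have ia : 0 < `|a^-1| `^ p by rewrite powR_gt0 // normr_gt0 invr_neq0 // gt_eqF.
by move: hs1; rewrite -(ltr_pM2l ia) mulrCA iap mulr1.
Qed.

(** * Successive choice of blocks *)

Let kappa : R := eps `^ p / 2 / 2.
Let K : R := 2 `^ p.
(** With this value [K * eta] is [kappa / 2], so that the tail error can be absorbed. *)
Let eta : R := kappa / (2 * K).

Lemma kappa_gt0 : 0 < kappa. Proof. by rewrite /kappa !divr_gt0 // powR_gt0. Qed.
Lemma K_gt0 : 0 < K. Proof. exact: powR_gt0. Qed.
Lemma eta_gt0 : 0 < eta.
Proof. by rewrite divr_gt0 ?kappa_gt0 // mulr_gt0 // K_gt0. Qed.

(** One step of the construction: [L] counts the positions and [m] bounds the coordinates already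
    used; [L'] and [m'] are the updated values. *)
Let is_block (r : R) (L m : nat) (z : nat -> R) (L' m' : nat) :=
  [/\ X z, dominated p v z 1, forall k, (k < m)%N -> z k = 0 /\ T z k = 0,
      (m <= m')%N /\
      (dominated p v (tail_from m' z) r /\ dominated p w (tail_from m' (T z)) r) &
      exists t, [/\ uniq t, forall k, k \in t -> (m <= k < m')%N,
        (L + size t)%N = L' & kappa <= wsum p w (T z) L t]].

Lemma exists_block r L m : 0 < r -> exists z L' m', is_block r L m z L' m'.
Proof.
move=> r0.
have [||d d0 dL] := exists_powR_mul_le p hp (\sum_(0 <= i < L) w i) kappa.
- by rewrite sumr_ge0.
- exact: kappa_gt0.
have [z [Xz z1 zm Tzd [s us hs]]] := exists_spread_vector d m d0.
(* This halves the mass of [T z] once more, whence the two halvings in [kappa]. *)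
have [|t [ut mt ht]] := far_block p hp w w0 wdec (T z) L m d _ s us _ Tzd dL hs.
  by move=> k /zm[].
have [_ dTz _] := nY_norm _ Xz.
have [m1 hm1] := dominated_tail p hp v v0 vdec vinf z 1 r z1 r0.
have [m2 hm2] := dominated_tail p hp w w0 wdec winf (T z) _ r dTz r0.
pose m' := maxn (maxn m1 m2) (maxn m (\max_(i <- t) i).+1).
exists z, (L + size t)%N, m'; split=> //.
  split; first by rewrite /m' leq_max orbC leq_max leqnn.
  by split; [apply: hm1|apply: hm2]; rewrite /m' !leq_max leqnn ?orbT.
exists t; split=> // k kt; rewrite mt //= /m' !leq_max !ltnS.
by rewrite (@leq_bigmax_seq _ t xpredT id k kt isT) !orbT.
Qed.

Lemma exists_block_sequence : exists (z : nat -> nat -> R) (L m : nat -> nat),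
  L 0%N = 0%N /\
  forall n, is_block (eta / K ^+ n.+1) (L n) (m n) (z n) (L n.+1) (m n.+1).
Proof.
(* The state is the step number with the pair [(L, m)]; choice gives a step function, which [pos]
   iterates. *)
have step (a : nat * (nat * nat)) : exists b : (nat -> R) * (nat * nat),
    is_block (eta / K ^+ a.1.+1) a.2.1 a.2.2 b.1 b.2.1 b.2.2.
  have r0 : 0 < eta / K ^+ a.1.+1.
    by rewrite divr_gt0 ?eta_gt0 // exprn_gt0 // K_gt0.
  by have [z [L [m h]]] := exists_block _ a.2.1 a.2.2 r0; exists (z, (L, m)).
have [f hf] := choice step.
pose pos := fix pos n := if n is n'.+1 then (f (n', pos n')).2 else (0%N, 0%N).
exists (fun n => (f (n, pos n)).1), (fun n => (pos n).1), (fun n => (pos n).2).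
by split=> // n; exact: hf (n, pos n).
Qed.

Lemma exists_lp_sequence : exists (z : nat -> nat -> R) (B B' : R),
  [/\ 0 <= B, 0 < B', forall j, X (z j),
    forall n (a : nat -> R), dominated p v (fun k => \sum_(j < n) a j * z j k)
      (B * \sum_(j < n) `|a j| `^ p) &
    forall n (a : nat -> R) c, dominated p w (fun k => \sum_(j < n) a j * T (z j) k) c ->
      \sum_(j < n) `|a j| `^ p <= B' * c].
Proof.
have [z [L [m [L0 zb]]]] := exists_block_sequence.
have mm n : (m n <= m n.+1)%N by have [_ _ _ []] := zb n.
have kp := kappa_gt0; have Kp := K_gt0.
exists z, (K * (1 + eta)), (2 * K / kappa); split.
- by rewrite mulr_ge0 // ?ltW // addr_gt0 // eta_gt0.
- by rewrite divr_gt0 // mulr_gt0.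
- by move=> j; have [] := zb j.
- move=> n a; apply: (dominated_blocks p hp v v0 m z mm).
  + by move=> j k km; have [_ _ /(_ k km)[]] := zb j.
  + by move=> j; have [] := zb j.
  + by move=> j; have [_ _ _ [_ []]] := zb j.
move=> n a c dc.
have := blocks_lower_estimate p hp w w0 m (fun j => T (z j)) mm _ L kappa L0 _ eta c a n _ dc.
set A := \sum_(j < n) _ => h.
have {h} : kappa * A <= K * (c + eta * A).
  apply: h => [j k km|j|j].
  - by have [_ _ /(_ k km)[]] := zb j.
  - by have [] := zb j.
  - by have [_ _ _ [_ []]] := zb j.
(* Moving [kappa / 2 * A] to the left gives the constant [2 * K / kappa]. *)
have -> : K * (c + eta * A) = K * c + kappa / 2 * A.
  by rewrite /eta; field; rewrite gt_eqF.
move=> h; rewrite mulrAC ler_pdivlMr //; lra.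
Qed.

(** * Closures and spans, with the p-th power of the norm *)

Let N x := nX x `^ p.

Lemma N_ge0 x : 0 <= N x. Proof. exact: powR_ge0. Qed.

Lemma X_add x y : X x -> X y -> X (fun k => x k + y k).
Proof. by have [_ [XD _]] := X_subspace; exact: XD. Qed.

Lemma X_scale a x : X x -> X (fun k => a * x k).
Proof. by have [_ [_ XZ]] := X_subspace; exact: XZ. Qed.

Lemma X_sub x y : X x -> X y -> X (fun k => x k - y k).
Proof.
move=> Xx Xy; rewrite (_ : (fun _ => _) = fun k => x k + (-1) * y k).
  by apply: X_add => //; exact: X_scale.
by apply/funext => k; rewrite mulN1r.
Qed.

Lemma N_add x y : X x -> X y -> N (fun k => x k + y k) <= K * (N x + N y).
Proof.
move=> Xx Xy; have [_ _] := nX_norm _ (X_add _ _ Xx Xy); apply.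
have [_ dx _] := nX_norm _ Xx; have [_ dy _] := nX_norm _ Xy.
exact: dominatedD.
Qed.

Lemma N_scale a x : X x -> N (fun k => a * x k) <= `|a| `^ p * N x.
Proof.
move=> Xx; have [_ _] := nX_norm _ (X_scale a _ Xx); apply.
by have [_ dx _] := nX_norm _ Xx; exact: dominatedZ.
Qed.

Lemma N_sub_sym x y : X x -> X y -> N (fun k => x k - y k) <= N (fun k => y k - x k).
Proof.
move=> Xx Xy; have := N_scale (-1) _ (X_sub _ _ Xy Xx).
rewrite normrN1 powR1 mul1r; apply: le_trans; rewrite le_eqVlt; apply/orP; left.
by apply/eqP; congr N; apply/funext => k; rewrite mulN1r opprB.
Qed.

Lemma N_sub_triangle x y z : X x -> X y -> X z ->
  N (fun k => x k - z k) <= K * (N (fun k => x k - y k) + N (fun k => y k - z k)).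
Proof.
move=> Xx Xy Xz; rewrite (_ : (fun _ => _) = fun k => (x k - y k) + (y k - z k)).
  by apply: N_add; exact: X_sub.
by apply/funext => k; rewrite addrA subrK.
Qed.

Definition closure_in (U : set (nat -> R)) : set (nat -> R) := fun x =>
  X x /\ forall e, 0 < e -> exists2 u, U u & N (fun k => u k - x k) <= e.

Lemma N_self x : X x -> N (fun k => x k - x k) = 0.
Proof.
move=> Xx; apply/eqP; rewrite eq_le N_ge0 andbT.
have := N_scale 0 _ Xx; rewrite normr0 powR0 ?exponent_neq0 // mul0r.
by under eq_fun do rewrite mul0r; under [in X in _ -> X]eq_fun do rewrite subrr.
Qed.

Lemma subset_closure_in U : U `<=` X -> U `<=` closure_in U.
Proof.
move=> UX x Ux; split=> [|e e0]; first exact: UX.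
by exists x; rewrite ?N_self ?ltW //; exact: UX.
Qed.

Lemma closure_in_closed_subspace U : U `<=` X -> is_subspace U ->
  closed_subspace X nX (closure_in U).
Proof.
move=> UX [U0 [UD UZ]]; have Kp := K_gt0; split; first by move=> x [].
split; first split.
- by apply: subset_closure_in.
- split=> [x y [Xx hx] [Xy hy]|a x [Xx hx]].
    split=> [|e e0]; first exact: X_add.
    have e1 : 0 < e / (2 * K) by rewrite divr_gt0 // mulr_gt0.
    have [u Uu ux] := hx _ e1; have [u' Uu' uy] := hy _ e1.
    exists (fun k => u k + u' k); first exact: UD.
    rewrite (_ : (fun _ => _) = fun k => (u k - x k) + (u' k - y k)); last first.
      by apply/funext => k; rewrite opprD addrACA.
    apply: le_trans (N_add _ _ _ _) _; try by apply: X_sub => //; exact: UX.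
    apply: le_trans (ler_wpM2l (ltW Kp) (lerD ux uy)) _.
    by rewrite le_eqVlt; apply/orP; left; apply/eqP; field; rewrite gt_eqF.
  split=> [|e e0]; first exact: X_scale.
  have a0 : 0 < `|a| `^ p + 1 by have := powR_ge0 `|a| p; lra.
  have [u Uu ux] := hx _ (divr_gt0 e0 a0).
  exists (fun k => a * u k); first exact: UZ.
  rewrite (_ : (fun _ => _) = fun k => a * (u k - x k)); last first.
    by apply/funext => k; rewrite mulrBr.
  apply: le_trans (N_scale _ _ _) _; first by apply: X_sub => //; exact: UX.
  apply: le_trans (ler_wpM2l (powR_ge0 _ _) ux) _.
  rewrite mulrA ler_pdivrMr //; have := powR_ge0 `|a| p; nra.
move=> u x hu Xx ux; split=> // e e0.
have e1 : 0 < e / (2 * K) by rewrite divr_gt0 // mulr_gt0.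
(* The p-th root turns convergence in norm into a bound on [N]. *)
have e2 : 0 < (e / (2 * K)) `^ p^-1 by rewrite powR_gt0.
have /cvgr0Pnorm_le/(_ _ e2)[n _ /(_ n (leqnn n)) hn] := ux.
have [Xun /(_ _ e1)[u' Uu' uu']] := hu n.
exists u' => //; apply: le_trans (N_sub_triangle _ (u n) _ _ _ _) _ => //; first exact: UX.
have un : N (fun k => u n k - x k) <= e / (2 * K).
  have [a0 _ _] := nX_norm _ (X_sub _ _ Xun Xx).
  move: hn; rewrite /= (ger0_norm a0) => /(powR_le _ _ a0) h; apply: le_trans h _.
  by rewrite powR_inv_powR // ltW.
apply: le_trans (ler_wpM2l (ltW Kp) (lerD uu' un)) _.
by rewrite le_eqVlt; apply/orP; left; apply/eqP; field; rewrite gt_eqF.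
Qed.

Definition span (z : nat -> nat -> R) : set (nat -> R) := fun x =>
  exists n (a : nat -> R), x = fun k => \sum_(j < n) a j * z j k.

Lemma span_widen (z : nat -> nat -> R) n n' (a : nat -> R) : (n <= n')%N ->
  exists a' : nat -> R, forall k,
    \sum_(j < n) a j * z j k = \sum_(j < n') a' j * z j k.
Proof.
move=> nn; exists (fun j => if (j < n)%N then a j else 0) => k.
rewrite (big_ord_widen n' (fun j => a j * z j k) nn) big_mkcond.
by apply: eq_bigr => j _; case: ifP => //; rewrite mul0r.
Qed.

Lemma span_subspace z : is_subspace (span z).
Proof.
split; first by exists 0%N, (fun=> 0); apply/funext => k; rewrite big_ord0.
split=> [x y [n [a ->]] [n' [b ->]]|c x [n [a ->]]].
  have [a' Ea] := span_widen z n (maxn n n') a (leq_maxl _ _).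
  have [b' Eb] := span_widen z n' (maxn n n') b (leq_maxr _ _).
  exists (maxn n n'), (fun j => a' j + b' j); apply/funext => k.
  by rewrite Ea Eb -big_split; apply: eq_bigr => j _; rewrite mulrDl.
exists n, (fun j => c * a j); apply/funext => k.
by rewrite mulr_sumr; apply: eq_bigr => j _; rewrite mulrA.
Qed.

Lemma dominated_image x : X x -> dominated p w (T x) (nY (T x) `^ p).
Proof. by move=> Xx; have [] := nY_norm _ Xx. Qed.

(** The upper estimate for [z] and the lower one for its images bound [N u] by [B * B'] times the
    p-th power of [nY (T u)] on the span; approximation extends this to the closure. *)
Lemma not_SS_of_bounded_below : ~ SS X nX nY T.
Proof.
apply; have [z [B [B' [B0 B'0 Xz zup zlow]]]] := exists_lp_sequence.
have Kp := K_gt0; have [D D1 TD] := T_bounded_pos.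
have spanX : span z `<=` X by move=> _ [n [a ->]]; exact: (subspace_sum X).
exists (closure_in (span z)); split; last split.
- exact: closure_in_closed_subspace spanX (span_subspace z).
- move=> n; exists z; split=> [i ni|c c0 i ni].
    apply: subset_closure_in spanX _ _; exists i.+1, (fun j => (j == i)%:R).
    apply/funext => k; rewrite big_ord_recr /= eqxx mul1r big1 ?add0r // => j _.
    by rewrite ltn_eqF ?ltn_ord // mul0r.
  (* A vanishing combination has image 0, so the lower estimate applies with bound 0. *)
  have : \sum_(j < n) `|c j| `^ p <= B' * 0.
    apply: zlow => s _; rewrite -(T_sum n c z (fun j _ => Xz j)).
    rewrite (_ : (fun _ => _) = fun k => 0 * z 0%N k).
      by rewrite T_scale // wsumZ // normr0 powR0 ?exponent_neq0 // mul0r.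
    by apply/funext => k; rewrite c0 mul0r.
  rewrite mulr0 => h; have {h} : \sum_(j < n) `|c j| `^ p == 0.
    by rewrite eq_le h sumr_ge0 // => j _; exact: powR_ge0.
  rewrite psumr_eq0 => [/allP/(_ (Ordinal ni))|j _]; last exact: powR_ge0.
  rewrite mem_index_enum => /(_ isT) /=.
  by rewrite powR_eq0 normr_eq0 => /andP[/eqP].
(* One factor [K] comes from replacing [x] by [u], the other from replacing [T u] by [T x]. *)
pose G := K * (B * B') * K.
have G0 : 0 <= G by rewrite /G !mulr_ge0 // ?ltW.
have below x : closure_in (span z) x -> N x <= G * nY (T x) `^ p.
  move=> [Xx hx]; apply/ler_addgt0Pr => e e0.
  (* An approximation error [e / H] adds at most [(K + G * D^p) * (e / H)], which is at most [e]. *)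
  pose H := K + G * D `^ p + 1.
  have H0 : 0 < H by have := powR_ge0 D p; rewrite /H; nra.
  have e1 : 0 < e / H by rewrite divr_gt0.
  have [u su ux] := hx _ e1; have Xu := spanX _ su.
  have Xux := X_sub _ _ Xu Xx; have Xxu := X_sub _ _ Xx Xu.
  have Nu : N u <= B * B' * nY (T u) `^ p.
    case: su Xu {ux Xux Xxu} => n [a ->] Xu.
    have [_ _ least] := nX_norm _ Xu; apply: le_trans (least _ (zup n a)) _.
    rewrite -mulrA ler_wpM2l //; apply: zlow.
    by rewrite -(T_sum n a z (fun j _ => Xz j)); exact: dominated_image.
  have Mu : nY (T u) `^ p <= K * (nY (T x) `^ p + D `^ p * (e / H)).
    have [_ _] := nY_norm _ Xu; apply.
    rewrite (_ : T u = fun k => T x k + T (fun k => u k - x k) k); last first.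
      by rewrite -T_add //; congr T; apply/funext => k; rewrite subrKC.
    apply: dominatedD => //; first exact: dominated_image.
    move=> s us; apply: le_trans (dominated_image _ Xux s us) _.
    have [a0 _ _] := nX_norm _ Xux; have [b0 _ _] := nY_norm _ Xux.
    apply: le_trans (powR_le _ _ b0 (TD _ Xux)) _.
    by rewrite powRM ?ler_wpM2l ?powR_ge0 // (le_trans ler01 D1).
  have : N x <= K * (N u + e / H).
    rewrite [X in N X](_ : _ = fun k => u k + (x k - u k)); last first.
      by apply/funext => k; rewrite subrKC.
    apply: le_trans (N_add _ _ Xu Xxu) _; rewrite ler_pM2l // lerD2l.
    exact: le_trans (N_sub_sym _ _ Xx Xu) ux.
  move/le_trans; apply.
  apply: le_trans (_ : G * nY (T x) `^ p + (K + G * D `^ p) * (e / H) <= _).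
    have BB : 0 <= B * B' by rewrite mulr_ge0 // ltW.
    have h : N u <= B * B' * (K * (nY (T x) `^ p + D `^ p * (e / H))).
      exact: le_trans Nu (ler_wpM2l BB Mu).
    apply: le_trans (ler_wpM2l (ltW Kp) (lerD h (lexx _))) _.
    by rewrite le_eqVlt; apply/orP; left; apply/eqP; rewrite /G; ring.
  rewrite lerD2l mulrCA ler_piMr ?(ltW e0) // ler_pdivrMr //.
  by rewrite /H mul1r lerDl.
have G1 : 0 < G + 1 by lra.
(* Since [G] may be 0, [G + 1] is inverted. *)
exists ((G + 1)^-1 `^ p^-1); split; first by rewrite powR_gt0 // invr_gt0.
move=> x hx; have [Xx _] := hx.
have [a0 _ _] := nX_norm _ Xx; have [b0 _ _] := nY_norm _ Xx.
apply: powR_le_cancel; rewrite ?mulr_ge0 ?powR_ge0 // powRM ?powR_ge0 //.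
rewrite powR_inv_powR ?invr_ge0 ?(ltW G1) // mulrC ler_pdivrMr //.
apply: le_trans (below _ hx) _; rewrite mulrC ler_wpM2l ?powR_ge0 //; lra.
Qed.

End BoundedBelow.

Lemma SS_FSS : SS X nX nY T -> FSS X nX nY T.
Proof.
move=> hSS eps eps0; apply: contrapT => /forallNP H.
apply: (not_SS_of_bounded_below eps eps0) hSS => n.
have /existsNP[Z /not_implyP[ZX /not_implyP[Zsub /not_implyP[Zdim Zn]]]] := H n.
exists Z; split=> // z Zz; rewrite leNgt; apply/negP => h; apply: Zn.
by exists z.
Qed.

End Operators.

(** * The converse inclusion and the three pairs of spaces *)

Lemma FSS_SS {R : realType} (X : set (nat -> R)) (nX nY : (nat -> R) -> R) T :
  FSS X nX nY T -> SS X nX nY T.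
Proof.
move=> hF [Z [[ZX [Zsub _]] [Zinf [c [c0 hc]]]]].
have [N hN] := hF c c0; have [z [Zz]] := hN Z ZX Zsub (Zinf N).
by rewrite ltNge hc.
Qed.

Lemma dominated_class_subspace {R : realType} (p : R) (w : nat -> R) (E : set (nat -> R)) :
  1 <= p -> (forall n, 0 <= w n) ->
  (forall x, E x <-> exists c, dominated p w x c) -> is_subspace E.
Proof.
move=> hp w0 hE; split; last split.
- apply/hE; exists 0 => s _; elim: s 0%N => //= i s IH k.
  by rewrite normr0 powR0 ?exponent_neq0 // mulr0 add0r.
- move=> x y /hE[c xc] /hE[d yd]; apply/hE; exists (2 `^ p * (c + d)).
  exact: dominatedD.
- by move=> a x /hE[c xc]; apply/hE; exists (`|a| `^ p * c); exact: dominatedZ.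
Qed.

Theorem theorem3p5 (R : realType) (p : R) (w : nat -> R)
  (hp : 1 <= p)
  (hw1 : w 0%N = 1)
  (hwdec : forall n, w n.+1 <= w n)
  (hw0 : w n @[n --> \oo] --> (0 : R))
  (hwsum : series w n @[n --> \oo] --> +oo) :
  (forall X Y : set (nat -> R),
     closed_subspace (dwp w p) (dnorm w p) X ->
     closed_subspace (dwp w p) (dnorm w p) Y ->
     forall T : (nat -> R) -> (nat -> R),
       bounded_linear X Y (dnorm w p) (dnorm w p) T ->
       (FSS X (dnorm w p) (dnorm w p) T <-> SS X (dnorm w p) (dnorm w p) T))
  /\
  (forall T : (nat -> R) -> (nat -> R),
     bounded_linear (lp p) (dwp w p) (lpnorm p) (dnorm w p) T ->
     (FSS (lp p) (lpnorm p) (dnorm w p) T <-> SS (lp p) (lpnorm p) (dnorm w p) T))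
  /\
  (forall T : (nat -> R) -> (nat -> R),
     bounded_linear (dwp w p) (dwp w p) (dnorm w p) (dnorm w p) T ->
     (FSS (dwp w p) (dnorm w p) (dnorm w p) T <-> SS (dwp w p) (dnorm w p) (dnorm w p) T)).
Proof.
have wdec : forall m n, (m <= n)%N -> w n <= w m.
  by apply/nonincreasing_seqP.
have w0 n : 0 <= w n.
  by rewrite -(cvg_lim (@Rhausdorff R) hw0); apply: nonincreasing_cvgn_ge => //; exact: cvgP hw0.
have wnorm x := dnorm_is_lorentz_norm p hp w w0 wdec x.
have dwp_subspace : is_subspace (dwp w p).
  apply: (dominated_class_subspace p w) => // x; split=> [/wnorm[_ xc _]|[c]].
    by eexists; exact: xc.
  exact: dominated_dwp.
have main X Y : X `<=` dwp w p -> is_subspace X -> Y `<=` dwp w p ->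
    forall T, bounded_linear X Y (dnorm w p) (dnorm w p) T ->
    FSS X (dnorm w p) (dnorm w p) T <-> SS X (dnorm w p) (dnorm w p) T.
  move=> XE Xsub YE T [TY [TD [TZ [C TC]]]]; split; first exact: FSS_SS.
  apply: (SS_FSS p hp w w w0 w0 wdec wdec hwsum hwsum X _ _ T Xsub _ _ TD TZ C TC).
    by move=> x /XE/wnorm.
  by move=> x /TY/YE/wnorm.
split; last split.
- by move=> X Y [XE [Xsub _]] [YE _] T; exact: main XE Xsub YE T.
- move=> T [TY [TD [TZ [C TC]]]]; split; first exact: FSS_SS.
  (* For l_p the weight of the domain is constantly 1. *)
  have one_inf : series (fun=> 1 : R) n @[n --> \oo] --> +oo.
    apply/cvgryPge => A; exists (Num.bound `|A|) => //= n hn.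
    rewrite /series /= sumr_const_nat subn0; apply: le_trans (ler_norm A) _.
    by apply: le_trans (ltW (archi_boundP (normr_ge0 A))) _; rewrite ler_nat.
  apply: (SS_FSS p hp (fun=> 1) w _ w0 _ wdec one_inf hwsum (lp p) _ _ T _ _ _ TD TZ C TC).
  + by [].
  + by [].
  + apply: (dominated_class_subspace p (fun=> 1)) => // x.
    split=> [/(lpnorm_is_lorentz_norm p hp)[_ xc _]|[c]]; first by eexists; exact: xc.
    exact: dominated_lp.
  + by move=> x; exact: lpnorm_is_lorentz_norm.
  + by move=> x /TY/wnorm.
- by move=> T; exact: main.
Qed.
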